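(* Let $G=(V,E)$ be a finite weighted graph with edge weights $\mu$, and let $\Omega\subset V$ be nonempty, such that $\widetilde{\Omega}$ is connected and $\delta\Omega$ has at least two vertices. Let $\lambda_1(\Omega)$ be the first nontrivial eigenvalue of the Dirichlet-to-Neumann operator $\Lambda$ on $\Omega$. Then $$\lambda_1(\Omega)\leq 2h_E(\widetilde{\Omega}).$$
   Context: $V$ is a finite set and $\mu:V\times V\to[0,\infty)$, $(x,y)\mapsto\mu_{xy}=\mu_{yx}$, is a symmetric weight function; $\{x,y\}\in E$ (written $x\sim y$) iff $\mu_{xy}>0$. Self-loops are allowed. For $\Omega_1,\Omega_2\subset V$, $E(\Omega_1,\Omega_2)=\{\{x,y\}\in E: x\in\Omega_1,y\in\Omega_2\}$. For $F\subset E$, $\mu(F)=\sum_{\{x,y\}\in F}\mu_{xy}$. The vertex boundary is $\delta\Omega=\{x\in V\setminus\Omega: x\sim y\text{ for some }y\in\Omega\}$, and $\overline{\Omega}=\Omega\cup\delta\Omega$. The graph $\widetilde{\Omega}$ has vertex set $\overline{\Omega}$ and edge set $E(\Omega,\overline{\Omega})$. The measure $m:\overline{\Omega}\to(0,\infty)$ is $m_x=\sum_{y\in V,\,y\sim x}\mu_{xy}$ for $x\in\Omega$ and $m_x=\sum_{y\in\Omega,\,y\sim x}\mu_{xy}$ for $x\in\delta\Omega$; $m(A)=\sum_{x\in A}m_x$. For $f:\overline{\Omega}\to\mathbb{R}$: $\Delta f(x)=\frac1{m_x}\sum_{y\sim x}\mu_{xy}(f(y)-f(x))$ for $x\in\Omega$,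 and $\frac{\partial f}{\partial n}(z)=\frac1{m_z}\sum_{x\in\Omega,\,x\sim z}\mu_{zx}(f(z)-f(x))$ for $z\in\delta\Omega$. For $\varphi:\delta\Omega\to\mathbb{R}$, $u_\varphi:\overline{\Omega}\to\mathbb{R}$ is the unique function with $\Delta u_\varphi=0$ on $\Omega$ and $u_\varphi=\varphi$ on $\delta\Omega$. The Dirichlet-to-Neumann operator is $\Lambda:\mathbb{R}^{\delta\Omega}\to\mathbb{R}^{\delta\Omega}$, $\Lambda\varphi=\frac{\partial u_\varphi}{\partial n}$; it is self-adjoint and nonnegative for $\langle\varphi,\psi\rangle_{\delta\Omega}=\sum_{x\in\delta\Omega}\varphi(x)\psi(x)m_x$, with eigenvalues $0=\lambda_0(\Omega)<\lambda_1(\Omega)\le\cdots$ listed with multiplicity. For $A\subset\overline{\Omega}$, $\partial_\Omega A=E(A,V\setminus A)\cap E(\Omega,\overline{\Omega})$. The Escobar-type Cheeger constant is $$h_E(\widetilde{\Omega})=\inf\left\{\frac{\mu(\partial_\Omega A)}{m(A\cap\delta\Omega)}: A\subset\overline{\Omega},\ 0<m(A\cap\delta\Omega)\le\tfrac12 m(\delta\Omega)\right\}.$$ *)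

(* Defs.v *)
From HB Require Import structures.
From mathcomp Require Import all_boot all_order all_algebra.
From mathcomp Require Import boolp classical_sets reals.
Set Implicit Arguments.
Unset Strict Implicit.
Unset Printing Implicit Defensive.
Import Order.TTheory GRing.Theory Num.Theory passmx.
Local Open Scope ring_scope.

Section WeightedGraph.
Context {R : realType} {V : finType}.
Variable mu : V -> V -> R.

Definition adj : rel V := fun x y => 0 < mu x y.

(* Edges are unordered pairs [set x; y]; the self-loop at x is [set x]. *)
Definition edges_between (A B : {set V}) : {set {set V}} :=
  [set e : {set V} | [exists x in A, exists y in B,
                        adj x y && (e == [set x; y]%SET)]]%SET.

(* The choice of an orientation (x, y) of e is immaterial for symmetric mu. *)
Definition edge_weight (e : {set V}) : R :=
  if [pick p : V * V | e == [set p.1; p.2]%SET] is Some p then mu p.1 p.2 else 0.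

Definition weight (F : {set {set V}}) : R := \sum_(e in F) edge_weight e.

Variable Omega : {set V}.

Definition bdry : {set V} :=
  [set x in ~: Omega | [exists y in Omega, adj x y]]%SET.

Definition cl : {set V} := Omega :|: bdry.

Notation cl_type := {x : V | x \in cl}.
Notation bdry_type := {x : V | x \in bdry}.

Lemma bdry_cl (x : V) : x \in bdry -> x \in cl.
Proof. by move=> xb; rewrite inE xb orbT. Qed.

Definition bdry_to_cl (z : bdry_type) : cl_type := Sub (val z) (bdry_cl (valP z)).

Definition tilde_connected : Prop :=
  forall x y : cl_type,
    connect [rel x y : cl_type |
              [set val x; val y]%SET \in edges_between Omega cl] x y.

(* Only the values on cl are meaningful. *)
Definition mass (x : V) : R :=
  if x \in Omega then \sum_(y | adj x y) mu x y
  else \sum_(y in Omega | adj x y) mu x y.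

Definition set_mass (A : {set V}) : R := \sum_(x in A) mass x.

(* laplace and normal_deriv are meaningful at the points of Omega and of bdry,
   respectively; the neighbours of a point of Omega all lie in cl. *)
Definition laplace (f : cl_type -> R) (x : cl_type) : R :=
  (mass (val x))^-1 *
  \sum_(y : cl_type | adj (val x) (val y)) mu (val x) (val y) * (f y - f x).

Definition normal_deriv (f : cl_type -> R) (z : cl_type) : R :=
  (mass (val z))^-1 *
  \sum_(x : cl_type | (val x \in Omega) && adj (val x) (val z))
     mu (val z) (val x) * (f z - f x).

Definition is_harmonic_ext (phi : {ffun bdry_type -> R^o})
    (u : {ffun cl_type -> R^o}) : Prop :=
  (forall x : cl_type, val x \in Omega -> laplace u x = 0) /\
  (forall z : bdry_type, u (bdry_to_cl z) = phi z).

Definition harmonic_ext (phi : {ffun bdry_type -> R^o}) :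
    {ffun cl_type -> R^o} :=
  xget 0 [set u | is_harmonic_ext phi u]%classic.

Definition dtn_fun (phi : {ffun bdry_type -> R^o}) : {ffun bdry_type -> R^o} :=
  [ffun z => normal_deriv (harmonic_ext phi) (bdry_to_cl z)].

(* linfun packages a function that has to be linear: see dtnE. *)
Definition dtn : 'End({ffun bdry_type -> R^o}) := linfun dtn_fun.

Definition is_spectrum (s : seq R) : Prop :=
  sorted <=%R s /\ forall a : R, count_mem a s = \dim (leigenspace dtn a).

Definition spectrum : seq R := xget [::] [set s | is_spectrum s]%classic.

(* Indices start at 0, the trivial eigenvalue. As dtn is self-adjoint, the
   spectrum has #|bdry| entries, so nth does not default for k < #|bdry|. *)
Definition dtn_eigenvalue (k : nat) : R := nth 0 spectrum k.

Definition edge_bdry (A : {set V}) : {set {set V}} :=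
  edges_between A (~: A) :&: edges_between Omega cl.

Definition escobar_cheeger : R :=
  inf [set r : R | exists A : {set V},
        [/\ A \subset cl,
            0 < set_mass (A :&: bdry) <= set_mass bdry / 2 &
            r = weight (edge_bdry A) / set_mass (A :&: bdry)]]%classic.

(* The lemmas below show that the objects picked by harmonic_ext, dtn and
   spectrum exist (for connected tilde Omega and nonempty bdry): see
   harmonic_extP, harmonic_ext_unique, dtnE and spectrumP. *)

Lemma adj_edge (x y : V) : (forall x y, mu x y = mu y x) ->
  [set x; y]%SET \in edges_between Omega cl -> adj x y.
Proof.
move=> sym; rewrite inE => /existsP[a /andP[_ /existsP[b /andP[_ /andP[ab /eqP e]]]]].
have : x \in [set a; b]%SET by rewrite -e !inE eqxx.
have : y \in [set a; b]%SET by rewrite -e !inE eqxx orbT.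
have : a \in [set x; y]%SET by rewrite e !inE eqxx.
have : b \in [set x; y]%SET by rewrite e !inE eqxx orbT.
rewrite !inE {e} => bxy axy /orP[]/eqP yE /orP[]/eqP xE; subst x y => //.
- by move: bxy ab; rewrite orbb => /eqP ->.
- by rewrite /adj sym.
- by move: axy ab; rewrite orbb => /eqP ->.
Qed.

Lemma harmonic_le0 (f : cl_type -> R) : (forall x y, mu x y = mu y x) -> tilde_connected ->
  (0 < #|bdry|)%N ->
  (forall x : cl_type, val x \in Omega -> laplace f x = 0) ->
  (forall z : bdry_type, f (bdry_to_cl z) = 0) ->
  forall x, f x <= 0.
Proof.
move=> sym conn /card_gt0P[z0 z0b] lapl fb x.
pose M : cl_type := [arg max_(i > x) f i]%O.
have leM y : f y <= f M by rewrite /M; case: arg_maxP => // i _; exact.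
apply: le_trans (leM x) _.
have fbd (w : cl_type) : val w \in bdry -> f w = 0.
  move=> wb; rewrite -(fb (exist (fun x => x \in bdry) (val w) wb)); congr f; exact: val_inj.
case/connectP: (conn M (bdry_to_cl (exist (fun x => x \in bdry) z0 z0b))) => p pth lastp.
have {lastp}: f (last M p) = 0 by rewrite -lastp fb.
move: pth (erefl (f M)); move: {1 2 4}M => w.
elim: p w => [|y p IH] w /= => [_ <- -> //|/andP[wy pth] fw flast].
have [wO|wO] := boolP (val w \in Omega); last first.
  have /fbd <- : val w \in bdry by move: (valP w); rewrite inE (negPf wO).
  by rewrite fw.
apply: (IH y) => //.
have awy := adj_edge sym wy.
have := lapl w wO; rewrite /laplace => /eqP; rewrite mulf_eq0 invr_eq0.
have muw t : adj (val w) (val t) -> mu (val w) (val t) * (f t - f w) <= 0.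
  by move=> /ltW h; rewrite mulr_ge0_le0 // subr_le0 fw.
have mpos : 0 < mass (val w).
  rewrite /mass wO (bigD1 (val y)) //= ltr_wpDr //.
  by apply: sumr_ge0 => i /andP[/ltW].
rewrite gt_eqF //= -oppr_eq0 -sumrN psumr_eq0; last first.
  by move=> t /muw; rewrite oppr_ge0.
move=> /allP/(_ y (mem_index_enum _))/implyP/(_ awy).
by rewrite oppr_eq0 mulf_eq0 gt_eqF //= subr_eq0 => /eqP ->.
Qed.

Lemma laplaceN (f : cl_type -> R) x : laplace (fun y => - f y) x = - laplace f x.
Proof.
rewrite /laplace -mulrN -sumrN; congr (_ * _); apply: eq_bigr => y _.
by rewrite -opprD -mulrN.
Qed.

Lemma laplace_lin (f g : cl_type -> R) a x :
  laplace (fun y => a * f y + g y) x = a * laplace f x + laplace g x.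
Proof.
rewrite /laplace mulrCA -mulrDr [a * \sum_(_ | _) _]mulr_sumr -big_split /=; congr (_ * _).
apply: eq_bigr => y _ /=; rewrite mulrCA -mulrDr [a * (_ - _)]mulrBr; congr (_ * _).
by rewrite opprD addrACA.
Qed.

Lemma normal_deriv_lin (f g : cl_type -> R) a x :
  normal_deriv (fun y => a * f y + g y) x = a * normal_deriv f x + normal_deriv g x.
Proof.
rewrite /normal_deriv mulrCA -mulrDr [a * \sum_(_ | _) _]mulr_sumr -big_split /=; congr (_ * _).
apply: eq_bigr => y _ /=; rewrite mulrCA -mulrDr [a * (_ - _)]mulrBr; congr (_ * _).
by rewrite opprD addrACA.
Qed.

Lemma harmonic_eq0 (f : cl_type -> R) : (forall x y, mu x y = mu y x) -> tilde_connected ->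
  (0 < #|bdry|)%N ->
  (forall x : cl_type, val x \in Omega -> laplace f x = 0) ->
  (forall z : bdry_type, f (bdry_to_cl z) = 0) ->
  forall x, f x = 0.
Proof.
move=> sym conn b0 lapl fb x; apply/eqP; rewrite eq_le harmonic_le0 //=.
rewrite -oppr_le0 (@harmonic_le0 (fun y => - f y)) // => [y yO|z].
  by rewrite laplaceN lapl // oppr0.
by rewrite fb oppr0.
Qed.

Lemma harmonic_ext_unique phi u v : (forall x y, mu x y = mu y x) -> tilde_connected ->
  (0 < #|bdry|)%N ->
  is_harmonic_ext phi u -> is_harmonic_ext phi v -> u = v.
Proof.
move=> sym conn b0 [lu bu] [lv bv]; apply/ffunP => x.
apply/eqP; rewrite -subr_eq0; apply/eqP; rewrite addrC -mulN1r.
apply: (@harmonic_eq0 (fun x => -1 * v x + u x)) => // [y yO|z].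
  by rewrite laplace_lin lu // lv // mulr0 addr0.
by rewrite bu bv mulN1r addNr.
Qed.

Lemma harmonic_ext_exists phi : (forall x y, mu x y = mu y x) -> tilde_connected ->
  (0 < #|bdry|)%N -> exists u, is_harmonic_ext phi u.
Proof.
move=> sym conn b0.
pose T (f : {ffun cl_type -> R^o}) : {ffun cl_type -> R^o} :=
  [ffun x => if val x \in Omega then laplace f x else f x].
have lapl_ext (f g : cl_type -> R) : f =1 g -> laplace f =1 laplace g.
  by move=> /funext ->.
have Tlin : linear T.
  move=> a f g; apply/ffunP => x; rewrite !ffunE.
  case: ifP => _ //; rewrite -[RHS]laplace_lin; apply: lapl_ext => y.
  by rewrite !ffunE.
pose TL := GRing.isLinear.Build _ _ _ _ T Tlin.
pose T' : {linear {ffun cl_type -> R^o} -> {ffun cl_type -> R^o}} := HB.pack T TL.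
have bO (z : bdry_type) : (val z \in Omega) = false.
  by move: (valP z); rewrite !inE => /andP[/negPf].
have ker0 : lker (linfun T') == 0%VS.
  rewrite -subv0; apply/subvP => f; rewrite memv_ker lfunE /= memv0 => /eqP Tf.
  apply/eqP/ffunP => x; rewrite ffunE; apply: harmonic_eq0 => // [y yO|z].
    by move/ffunP/(_ y): Tf; rewrite !ffunE yO.
  by move/ffunP/(_ (bdry_to_cl z)): Tf; rewrite !ffunE /= bO.
pose g : {ffun cl_type -> R^o} := [ffun x : cl_type =>
  if insub (val x) is Some z then phi (z : bdry_type) else (0 : R^o)].
exists ((linfun T')^-1%VF g).
have := lker0_lfunVK ker0 g; rewrite lfunE /=; set u := (_^-1%VF _) => Tu.
split=> [x xO|z].
  move/ffunP/(_ x): Tu; rewrite !ffunE xO => ->.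
  by case: insubP => // z _ zx; move: (bO z); rewrite zx xO.
by move/ffunP/(_ (bdry_to_cl z)): Tu; rewrite !ffunE /= bO => ->; rewrite valK.
Qed.

Lemma harmonic_extP phi : (forall x y, mu x y = mu y x) -> tilde_connected ->
  (0 < #|bdry|)%N -> is_harmonic_ext phi (harmonic_ext phi).
Proof. by move=> sym conn b0; apply: xgetPex; exact: harmonic_ext_exists. Qed.

Lemma dtnE phi : (forall x y, mu x y = mu y x) -> tilde_connected -> (0 < #|bdry|)%N ->
  dtn phi = dtn_fun phi.
Proof.
move=> sym conn b0.
have lin : linear dtn_fun.
  move=> a f g; apply/ffunP => z; rewrite !ffunE.
  have -> : harmonic_ext (a *: f + g) = a *: harmonic_ext f + harmonic_ext g.
    apply: (@harmonic_ext_unique (a *: f + g)) => //; first exact: harmonic_extP.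
    have [lf bf] := harmonic_extP f sym conn b0.
    have [lg bg] := harmonic_extP g sym conn b0.
    split=> [x xO|w]; last by rewrite !ffunE bf bg.
    have := laplace_lin (harmonic_ext f) (harmonic_ext g) a x.
    rewrite lf // lg // mulr0 addr0 => <-; congr laplace.
    by apply/funext => y; rewrite !ffunE.
  rewrite -[RHS]normal_deriv_lin; congr normal_deriv.
  by apply/funext => y; rewrite !ffunE.
pose L := GRing.isLinear.Build _ _ _ _ dtn_fun lin.
pose T' : {linear {ffun bdry_type -> R^o} -> {ffun bdry_type -> R^o}} :=
  HB.pack dtn_fun L.
by rewrite /dtn -[dtn_fun]/(T' : _ -> _) lfunE.
Qed.

Lemma roots_seq (p : {poly R}) : p != 0 ->
  exists2 s : seq R, uniq s & forall a, root p a -> a \in s.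
Proof.
elim: {p}(size p) {-2}p (leqnn (size p)) => [|n IH] p sp p0.
  by move: sp; rewrite leqn0 size_poly_eq0 (negPf p0).
have [[a pa]|na] := pselect (exists a, root p a); last first.
  by exists [::] => // a pa; case: na; exists a.
have /factor_theorem[q pq] := pa.
have q0 : q != 0 by apply: contraNneq p0 => q0; rewrite pq q0 mul0r.
have [|s us rs] := IH q _ q0.
  by move: sp; rewrite pq size_Mmonic ?monicXsubC // size_XsubC addn2.
exists (undup (a :: s)) => [|b]; first exact: undup_uniq.
rewrite mem_undup inE pq rootM root_XsubC => /orP[/rs ->|->//].
by rewrite orbT.
Qed.

Lemma spectrumP : is_spectrum spectrum.
Proof.
apply: xgetPex.
pose e := vbasis {: {ffun bdry_type -> R^o}}.
have eb : basis_of {: {ffun bdry_type -> R^o}} e := vbasisP _.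
have [s us rs] := roots_seq (monic_neq0 (char_poly_monic (mxof e e dtn))).
exists (sort <=%R (flatten [seq nseq (\dim (leigenspace dtn a)) a | a <- s])).
split=> [|a]; first exact: sort_le_sorted.
rewrite (permP (permEl (perm_sort _ _))) count_flatten sumnE !big_map.
have cnt b : count_mem a (nseq (\dim (leigenspace dtn b)) b) =
    if b == a then \dim (leigenspace dtn a) else 0%N.
  by rewrite count_nseq /=; case: eqP => [->|_]; rewrite ?mul1n ?mul0n.
rewrite (eq_bigr _ (fun b _ => cnt b)).
have [as_|/(contra (rs a))] := boolP (a \in s).
  by rewrite (bigD1_seq a) //= eqxx big1 ?addn0 // => b /negPf ->.
rewrite -eigenvalue_root_char /eigenvalue negbK => /eqP e0.
rewrite (leigenspaceE eb) e0 vsof0 // dimv0 big1 // => b _.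
by case: ifP.
Qed.


End WeightedGraph.

(* Main.v *)
(** By Green's formula [<Lambda phi, phi>] is the Dirichlet energy of the harmonic
    extension of [phi], which is at most the energy of any other extension. For
    [A] admissible in the Cheeger constant, the indicator of [A] has energy
    [weight (edge_bdry A)], while the squared distance of its boundary values to
    the constants is [a - a ^ 2 / M >= a / 2], where [a] and [M] are the masses
    of [A :&: bdry] and [bdry]. The Rayleigh characterization of the first
    nontrivial eigenvalue then gives the bound. *)
Require Import Defs.
From HB Require Import structures.
From mathcomp Require Import all_boot all_order all_algebra.
From mathcomp Require Import boolp classical_sets reals.
From mathcomp Require Import ring lra.
Set Implicit Arguments.
Unset Strict Implicit.
Unset Printing Implicit Defensive.
Import Order.TTheory GRing.Theory Num.Theory.
Local Open Scope ring_scope.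

(** * Weighted inner products and the least eigenvalue of a positive semidefinite operator *)

Section WeightedInnerProduct.
Context {R : realType} {I : finType}.
Variable m : I -> R.
Notation E := {ffun I -> R^o}.
Implicit Types (x y z : E) (f g h : 'End(E)) (a b : R).

Definition dotm x y : R := \sum_i m i * (x i * y i).

Lemma dotmC x y : dotm x y = dotm y x.
Proof. by apply: eq_bigr => i _; rewrite (mulrC (x i)). Qed.

Lemma dotmDl x y z : dotm (x + y) z = dotm x z + dotm y z.
Proof. by rewrite -big_split; apply: eq_bigr => i _ /=; rewrite ffunE mulrDl mulrDr. Qed.

Lemma dotmZl a x y : dotm (a *: x) y = a * dotm x y.
Proof.
rewrite [RHS]mulr_sumr; apply: eq_bigr => i _; rewrite ffunE.
by rewrite -[_ *: _]/(a * x i); ring.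
Qed.

Lemma dotmDr x y z : dotm z (x + y) = dotm z x + dotm z y.
Proof. by rewrite dotmC dotmDl !(dotmC z). Qed.

Lemma dotmZr a x y : dotm y (a *: x) = a * dotm y x.
Proof. by rewrite dotmC dotmZl (dotmC y). Qed.

Lemma dotm0l x : dotm 0 x = 0.
Proof. by rewrite -(scale0r x) dotmZl mul0r. Qed.

(** Up to the factor [dotm y y], [P] is the orthogonal projection onto the line of [y]. With [y]
    constant, it later serves to shift the trivial eigenvalue. *)
Lemma rank_one_endo y : exists P : 'End(E), forall x, P x = dotm x y *: y.
Proof.
pose p x := dotm x y *: y.
have plin : linear p by move=> a u v; rewrite /p dotmDl dotmZl scalerDl scalerA.
pose L := GRing.isLinear.Build _ _ _ _ p plin.
pose q : {linear E -> E} := HB.pack p L.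
by exists (linfun q) => x; rewrite lfunE.
Qed.

Hypothesis m_gt0 : forall i, 0 < m i.

Lemma dotm_ge0 x : 0 <= dotm x x.
Proof. by apply: sumr_ge0 => i _; rewrite mulr_ge0 ?(ltW (m_gt0 i)) // -expr2 sqr_ge0. Qed.

Lemma dotm_gt0 x : x != 0 -> 0 < dotm x x.
Proof.
move=> x0; rewrite lt_def dotm_ge0 andbT; apply: contra x0.
rewrite psumr_eq0 => [/allP x0|i _]; last first.
  by rewrite mulr_ge0 ?(ltW (m_gt0 i)) // -expr2 sqr_ge0.
apply/eqP/ffunP => i; rewrite ffunE; apply/eqP.
by move: (x0 i (mem_index_enum _)); rewrite /= mulf_eq0 gt_eqF //= mulf_eq0 orbb.
Qed.

Lemma sqr_sum_le (J : finType) (F : J -> R) :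
  (\sum_j F j) ^+ 2 <= #|J|%:R * \sum_j F j ^+ 2.
Proof.
rewrite expr2 mulr_suml.
apply: (@le_trans _ _ (\sum_i \sum_j (F i ^+ 2 / 2 + F j ^+ 2 / 2))).
  apply: ler_sum => i _; rewrite mulr_sumr; apply: ler_sum => j _.
  by have := sqr_ge0 (F i - F j); nra.
rewrite le_eqVlt; apply/orP; left; apply/eqP.
under eq_bigr => i _ do rewrite big_split /= sumr_const.
by rewrite big_split /= sumr_const sumrMnl -mulrnDl -!mulr_suml -splitr mulr_natl.
Qed.

(** Expand [x] in the standard basis and apply Cauchy-Schwarz in each coordinate; dividing [k j] by
    [m j] restores the weighted norm on the right. *)
Lemma lfun_dotm_bounded h :
  exists2 K : R, 0 < K & forall x, dotm (h x) (h x) <= K * dotm x x.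
Proof.
pose e j : E := [ffun i => (i == j)%:R].
have hE x i : h x i = \sum_j x j * h (e j) i.
  have {1}-> : x = \sum_j x j *: e j.
    apply/ffunP => k; rewrite sum_ffunE (bigD1 k) //= !ffunE eqxx.
    rewrite big1 ?addr0 ?[_ *: _]mulr1 // => j /negPf jk.
    by rewrite !ffunE eq_sym jk [_ *: _]mulr0.
  by rewrite linear_sum sum_ffunE; apply: eq_bigr => j _; rewrite linearZ ffunE.
pose k j := #|I|%:R * \sum_i m i * h (e j) i ^+ 2.
have k0 j : 0 <= k j.
  rewrite mulr_ge0 ?ler0n //; apply: sumr_ge0 => i _.
  by rewrite mulr_ge0 ?sqr_ge0 ?(ltW (m_gt0 i)).
have km0 j : 0 <= k j / m j by rewrite divr_ge0 ?k0 ?(ltW (m_gt0 j)).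
exists (1 + \sum_j k j / m j) => [|x].
  by rewrite ltr_pwDl ?ltr01 ?sumr_ge0.
apply: (@le_trans _ _ (\sum_j k j * x j ^+ 2)); last first.
  rewrite mulr_sumr; apply: ler_sum => j _; rewrite -expr2 [leRHS]mulrA.
  apply: ler_wpM2r; first exact: sqr_ge0.
  rewrite -ler_pdivrMr // (bigD1 j) //= addrCA lerDl addr_ge0 ?ler01 //.
  by apply: sumr_ge0.
apply: (@le_trans _ _ (\sum_i m i * (#|I|%:R * \sum_j (x j * h (e j) i) ^+ 2))).
  apply: ler_sum => i _; apply: ler_wpM2l; first exact/ltW.
  by rewrite -expr2 hE sqr_sum_le.
rewrite le_eqVlt; apply/orP; left; apply/eqP.
under eq_bigr => i _ do rewrite mulrCA mulr_sumr mulr_sumr.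
under [RHS]eq_bigr => j _ do rewrite -mulrA mulr_suml mulr_sumr.
rewrite exchange_big; apply: eq_bigr => j _; apply: eq_bigr => i _ /=.
by ring.
Qed.

Definition dotm_sym f := forall x y, dotm (f x) y = dotm x (f y).
Definition dotm_psd f := forall x, 0 <= dotm (f x) x.

(* Testing positivity at [x - t g x] with [t] small gives [|g x|^2 <= C <g x, x>]. *)
Lemma psd_inj_coercive g : dotm_sym g -> dotm_psd g -> lker g == 0%VS ->
  exists2 e : R, 0 < e & forall x, e * dotm x x <= dotm (g x) x.
Proof.
move=> gS gP g0.
have [K K0 gK] := lfun_dotm_bounded g.
have [H H0 hH] := lfun_dotm_bounded (g^-1)%VF.
(* This constant comes from [2 <g y, y> <= |g y|^2 + |y|^2 <= (K + 1) |y|^2]. *)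
pose C := (K + 1) / 2.
have C0 : 0 < C by rewrite /C; lra.
have gC y : dotm (g y) y <= C * dotm y y.
  have := dotm_ge0 (g y + (-1) *: y); have := gK y.
  rewrite !dotmDl !dotmDr !dotmZl !dotmZr (dotmC y (g y)) /C; lra.
have gx x : dotm (g x) (g x) <= C * dotm (g x) x.
  have := gP (x + (- C^-1) *: g x); have := gC (g x).
  rewrite linearD linearZ /= !dotmDl !dotmDr !dotmZl !dotmZr (gS (g x) x).
  set p := dotm (g (g x)) _; set q := dotm (g x) (g x); set r := dotm (g x) x.
  (* With [t = C^-1], positivity reads [0 <= r - 2 C^-1 q + C^-2 p]; inserting [p <= C q] leaves
     [C^-1 q <= r]. *)
  move=> pC; rewrite -ler_pdivrMl //.
  have : C^-1 * (C^-1 * p) <= C^-1 * q.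
    by rewrite ler_pM2l ?invr_gt0 // ler_pdivrMl.
  by lra.
exists (H * C)^-1; first by rewrite invr_gt0 (mulr_gt0 H0 C0).
move=> x; rewrite ler_pdivrMl ?(mulr_gt0 H0 C0) //.
(* The bounded inverse gives [|x|^2 <= H |g x|^2], and [gx] bounds the right side by
   [H C <g x, x>]. *)
have := hH (g x); rewrite lker0_lfunK // => /le_trans; apply.
by rewrite -mulrA ler_pM2l.
Qed.

(* The eigenvalue is the infimum [c] of the Rayleigh quotient: were [f - c]
   injective, it would be coercive, and [c] could be increased. *)
Lemma psd_min_eigenvalue f : (0 < #|I|)%N -> dotm_sym f -> dotm_psd f ->
  exists c : R, [/\ 0 <= c, exists2 x, x != 0 & f x = c *: x
              & forall x, c * dotm x x <= dotm (f x) x].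
Proof.
move=> /card_gt0P[i0 _] fS fP.
pose S := [set r : R | exists2 x, x != 0 & r = dotm (f x) x / dotm x x]%classic.
have S0 : lbound S 0.
  by move=> _ [x x0 ->]; rewrite divr_ge0 ?fP ?dotm_ge0.
have SN : (S !=set0)%classic.
  pose x : E := [ffun=> 1]; exists (dotm (f x) x / dotm x x), x => //.
  by apply/eqP => /ffunP/(_ i0); rewrite !ffunE => /eqP; rewrite oner_eq0.
have infS : has_inf S by split=> //; exists 0.
pose c := inf S; exists c.
have c_le x : c * dotm x x <= dotm (f x) x.
  have [->|x0] := eqVneq x 0; first by rewrite linear0 !dotm0l mulr0.
  rewrite -ler_pdivlMr ?dotm_gt0 //; apply: ge_inf; first by exists 0.
  by exists x.
pose g : 'End(E) := (f - c *: \1)%VF.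
have gE x : g x = f x + (- c) *: x by rewrite /g add_lfunE opp_lfunE scale_lfunE id_lfunE [in RHS]scaleNr.
split=> //; first by apply: lb_le_inf.
have [/psd_inj_coercive co|ker0] := boolP (lker g == 0%VS).
  have [x y||e e0 ge] := co.
  - by rewrite !gE dotmDl dotmDr dotmZl dotmZr fS.
  - by move=> x; rewrite gE dotmDl dotmZl mulNr subr_ge0.
  (* Coercivity of [f - c] makes [c + e] a lower bound of the Rayleigh quotients, contradicting the
     choice of [c]. *)
  have : c + e <= c.
    apply: lb_le_inf => // _ [x x0 ->]; rewrite ler_pdivlMr ?dotm_gt0 //.
    by have := ge x; rewrite gE dotmDl dotmZl; lra.
  by lra.
exists (vpick (lker g)); first by rewrite vpick0.
by apply/eqP; rewrite -subr_eq0 -(scaleNr c) -gE -memv_ker memv_pick.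
Qed.

End WeightedInnerProduct.

(** * The Dirichlet form, Green's formula and the Dirichlet principle *)

Section DirichletForm.
Context {R : realType} {V : finType}.
Variables (mu : V -> V -> R) (Omega : {set V}).
Hypothesis mu_ge0 : forall x y : V, 0 <= mu x y.
Hypothesis mu_sym : forall x y : V, mu x y = mu y x.
Hypothesis conn : tilde_connected mu Omega.
Hypothesis bdry_gt0 : (0 < #|bdry mu Omega|)%N.

Notation bd := (bdry mu Omega).
Notation C := {x : V | x \in cl mu Omega}.
Notation B := {x : V | x \in bd}.
Notation toC := (@bdry_to_cl R V mu Omega).
Notation Ext := (harmonic_ext (mu := mu) (Omega := Omega)).
Notation Lambda := (dtn mu Omega).
Implicit Types (f g h : C -> R) (phi psi : {ffun B -> R^o}).

Definition tilde_weight (x y : V) : R :=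
  if (x \in Omega) || (y \in Omega) then mu x y else 0.

(** The one-sided form makes Green's formula a matter of reading off rows; [dirichletE] recovers the
    usual half-sum over ordered pairs. *)
Definition dirichlet f g : R :=
  \sum_x \sum_y tilde_weight (val x) (val y) * ((f x - f y) * g x).

Definition bdry_mass (z : B) : R := mass mu Omega (val z).

Notation dot := (dotm bdry_mass).

Lemma tilde_weight_ge0 x y : 0 <= tilde_weight x y.
Proof. by rewrite /tilde_weight; case: ifP. Qed.

Lemma tilde_weightC x y : tilde_weight x y = tilde_weight y x.
Proof. by rewrite /tilde_weight orbC mu_sym. Qed.

Lemma not_adj (x y : V) : ~~ adj mu x y -> mu x y = 0.
Proof. by move=> xy; apply/eqP; rewrite eq_le mu_ge0 andbT leNgt. Qed.

Lemma dirichletE f g : dirichlet f g =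
  (\sum_x \sum_y tilde_weight (val x) (val y) * ((f x - f y) * (g x - g y))) / 2.
Proof.
have swap : dirichlet f g =
    \sum_x \sum_y tilde_weight (val x) (val y) * ((f x - f y) * - g y).
  rewrite /dirichlet exchange_big; apply: eq_bigr => x _; apply: eq_bigr => y _.
  by rewrite /= tilde_weightC; ring.
have -> : dirichlet f g = (dirichlet f g + dirichlet f g) / 2 by field.
congr (_ / 2); rewrite {2}swap -big_split; apply: eq_bigr => x _ /=.
by rewrite -big_split; apply: eq_bigr => y _ /=; ring.
Qed.

Lemma dirichletC f g : dirichlet f g = dirichlet g f.
Proof.
rewrite !dirichletE; congr (_ / 2).
by apply: eq_bigr => x _; apply: eq_bigr => y _ /=; ring.
Qed.

Lemma dirichlet_ge0 f : 0 <= dirichlet f f.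
Proof.
rewrite dirichletE divr_ge0 //; apply: sumr_ge0 => x _; apply: sumr_ge0 => y _.
by rewrite mulr_ge0 ?tilde_weight_ge0 // -expr2 sqr_ge0.
Qed.

Lemma dirichletBl f g h :
  dirichlet (fun x => f x - g x) h = dirichlet f h - dirichlet g h.
Proof.
rewrite -sumrB; apply: eq_bigr => x _; rewrite -sumrB; apply: eq_bigr => y _.
by ring.
Qed.

Lemma bdry_mass_gt0 (z : B) : 0 < bdry_mass z.
Proof.
rewrite /bdry_mass /mass; move: (valP z); rewrite !inE => /andP[/negPf ->].
move=> /existsP[y /andP[yO zy]]; rewrite (bigD1 y) /=; last exact/andP.
by rewrite ltr_pwDl // sumr_ge0.
Qed.

Lemma laplace_eq0 f (x : C) : val x \in Omega -> laplace f x = 0 ->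
  \sum_y tilde_weight (val x) (val y) * (f x - f y) = 0.
Proof.
move=> xO; rewrite /laplace => lap.
set S := \sum_(_ | _) _ in lap.
have -> : \sum_y tilde_weight (val x) (val y) * (f x - f y) = - S.
  rewrite /S [in RHS]big_mkcond -sumrN; apply: eq_bigr => y _.
  rewrite /tilde_weight xO /=; case: ifPn => [_|/not_adj ->]; first by ring.
  by rewrite mul0r oppr0.
move/eqP: lap; rewrite mulf_eq0 invr_eq0 => /orP[|/eqP ->]; last by rewrite oppr0.
(* If the mass of [x] is 0, its inverse is 0 by convention and harmonicity says nothing; but then
   all weights at [x] vanish, and so does [S]. *)
rewrite /mass xO psumr_eq0 => [/allP m0|y /ltW //].
rewrite /S big1 ?oppr0 // => y xy.
move: (m0 (val y) (mem_index_enum _)); rewrite xy /= => /eqP ->.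
by rewrite mul0r.
Qed.

Lemma normal_derivE f (z : B) : bdry_mass z * normal_deriv f (toC z) =
  \sum_y tilde_weight (val z) (val y) * (f (toC z) - f y).
Proof.
rewrite /normal_deriv mulrA divff ?gt_eqF ?bdry_mass_gt0 // mul1r.
rewrite big_mkcond; apply: eq_bigr => y _; rewrite /tilde_weight.
have -> /= : (val z \in Omega) = false.
  by move: (valP z); rewrite !inE => /andP[/negPf].
case: (val y \in Omega) => /=; last by rewrite mul0r.
by case: ifPn => // /not_adj; rewrite mu_sym => ->; rewrite mul0r.
Qed.

(** Split the outer sum of the form: rows at points of [Omega] vanish by harmonicity, and the row at
    a boundary point [z] is its mass times the normal derivative. *)
Lemma green phi g : dot (Lambda phi) [ffun z => g (toC z)] = dirichlet (Ext phi) g.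
Proof.
have [lap _] := harmonic_extP phi mu_sym conn bdry_gt0.
under [RHS]eq_bigr => x _ do under eq_bigr => y _ do rewrite mulrA.
under [RHS]eq_bigr => x _ do rewrite -mulr_suml.
rewrite (bigID (fun x : C => val x \in Omega)) /= big1 ?add0r => [|x xO]; last first.
  by rewrite laplace_eq0 ?mul0r // lap.
rewrite (reindex_omap toC (fun x => insub (val x))) => [|x xO] /=; last first.
  have xb : val x \in bd by move: (valP x); rewrite inE (negPf xO).
  by rewrite insubT /=; congr Some; apply: val_inj.
apply: eq_big => [z|z _].
  rewrite valK eqxx andbT; symmetry.
  by move: (valP z); rewrite !inE => /andP[].
by rewrite dtnE // !ffunE mulrA normal_derivE.
Qed.

Lemma dot_dtn phi psi : dot (Lambda phi) psi = dirichlet (Ext phi) (Ext psi).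
Proof.
have [_ bpsi] := harmonic_extP psi mu_sym conn bdry_gt0.
by rewrite -green; congr dotm; apply/ffunP => z; rewrite ffunE bpsi.
Qed.

Lemma dtn_sym : dotm_sym bdry_mass Lambda.
Proof. by move=> phi psi; rewrite [RHS]dotmC !dot_dtn dirichletC. Qed.

Lemma dtn_psd : dotm_psd bdry_mass Lambda.
Proof. by move=> phi; rewrite dot_dtn dirichlet_ge0. Qed.

(** Expand the nonnegative energy of [g - u]. Since [g] and [u] agree on the boundary, Green's
    formula gives the cross terms and the energy of [u] the same value, [<Lambda phi, phi>]. *)
Lemma dirichlet_principle g :
  dot (Lambda [ffun z => g (toC z)]) [ffun z => g (toC z)] <= dirichlet g g.
Proof.
set phi := [ffun _ => _]; pose u := Ext phi.
have := dirichlet_ge0 (fun x => g x - u x).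
rewrite dirichletBl !(dirichletC _ (fun x => g x - u x)) !dirichletBl.
rewrite (dirichletC g u) -!green -/phi.
have -> : [ffun z => u (toC z)] = phi.
  have [_ bphi] := harmonic_extP phi mu_sym conn bdry_gt0.
  by apply/ffunP => z; rewrite ffunE bphi.
by lra.
Qed.

Definition bdry_one : {ffun B -> R^o} := [ffun=> 1].

Lemma dtn_one : Lambda bdry_one = 0.
Proof.
have -> : Lambda bdry_one = dtn_fun bdry_one by apply: dtnE.
have -> : dtn_fun bdry_one = 0 :> {ffun B -> R^o}; last by [].
have E1 : Ext bdry_one = [ffun=> 1].
  apply: (harmonic_ext_unique mu_sym conn bdry_gt0 (harmonic_extP _ mu_sym conn bdry_gt0)).
  split=> [x _|z]; last by rewrite !ffunE.
  by rewrite /laplace big1 ?mulr0 // => y _; rewrite !ffunE subrr mulr0.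
apply/ffunP => z; rewrite !ffunE E1 /normal_deriv big1 ?mulr0 // => y _.
by rewrite !ffunE subrr mulr0.
Qed.

(** * Edge weights and the energy of an indicator *)

Lemma edge_weight2 (x y : V) : edge_weight mu [set x; y] = mu x y.
Proof.
rewrite /edge_weight; case: pickP => [[a b] /= /eqP|/(_ (x, y))]; last by rewrite eqxx.
move=> e.
have : a \in [set x; y] by rewrite e !inE eqxx.
have : b \in [set x; y] by rewrite e !inE eqxx orbT.
have : x \in [set a; b] by rewrite -e !inE eqxx.
have : y \in [set a; b] by rewrite -e !inE eqxx orbT.
rewrite !inE => + + /orP[]/eqP eb /orP[]/eqP ea; rewrite ea eb ?orbb //.
- by move=> /eqP ->.
- by move=> _ /eqP ->.
Qed.

Lemma edge_weight_ge0 e : 0 <= edge_weight mu e.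
Proof. by rewrite /edge_weight; case: pickP. Qed.

(** In the one-sided form only ordered pairs leaving [A] contribute, each its weight. Sending such a
    pair to its edge is injective, so no boundary edge is charged twice. *)
Lemma dirichlet_indicator (A : {set V}) :
  dirichlet (fun x => (val x \in A)%:R) (fun x => (val x \in A)%:R)
    <= weight mu (edge_bdry mu Omega A).
Proof.
pose P := [set p : C * C | [&& val p.1 \in A, val p.2 \notin A,
  (val p.1 \in Omega) || (val p.2 \in Omega) & adj mu (val p.1) (val p.2)]].
pose edge (p : C * C) : {set V} := [set val p.1; val p.2].
(* The orientation is recovered from the edge: one end lies in [A], the other outside. *)
have edge_inj : {in P &, injective edge}.
  move=> [a b] [x y]; rewrite !inE /= => /and4P[aA bA _ _] /and4P[xA yA _ _].
  rewrite /edge /= => /setP e; congr pair; apply: val_inj.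
  - move: (e (val a)); rewrite !inE eqxx => /esym/orP[]/eqP // ay.
    by move: yA; rewrite -ay aA.
  - move: (e (val b)); rewrite !inE eqxx orbT => /esym/orP[]/eqP // bx.
    by move: bA; rewrite bx xA.
have edge_sub : edge @: P \subset edge_bdry mu Omega A.
  apply/fintype.subsetP => _ /imsetP[[x y] + ->]; rewrite !inE /= => /and4P[xA yA xyO xy].
  apply/andP; split.
    by apply/existsP; exists (val x); rewrite xA; apply/existsP; exists (val y);
      rewrite inE yA xy eqxx.
  case/orP: xyO => [xO|yO].
    by apply/existsP; exists (val x); rewrite xO; apply/existsP; exists (val y);
      rewrite (valP y) xy eqxx.
  apply/existsP; exists (val y); rewrite yO; apply/existsP; exists (val x).
  by rewrite (valP x) /adj mu_sym -/(adj mu _ _) xy /edge finset.setUC eqxx.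
apply: (@le_trans _ _ (\sum_(e in edge @: P) edge_weight mu e)); last first.
  rewrite /weight [leRHS](big_setID (edge @: P)) /= (finset.setIidPr edge_sub) lerDl.
  by apply: sumr_ge0 => e _; exact: edge_weight_ge0.
rewrite big_imset //= /dirichlet pair_bigA big_mkcond [leRHS]big_mkcond /=.
apply: ler_sum => -[x y] _ /=; rewrite inE /= edge_weight2.
case: (val x \in A) => /=; last by rewrite !mulr0.
case: (val y \in A) => /=; first by rewrite subrr mul0r mulr0.
rewrite subr0 !mulr1 /tilde_weight; case: ifP => //= _.
by case: ifPn => // /not_adj ->.
Qed.

(** * The first nontrivial eigenvalue and its Rayleigh bound *)

Lemma nth1_sorted_le (s : seq R) (c : R) :
  sorted <=%R s -> (1 < count (fun a : R => (a <= c)%R) s)%N -> nth 0 s 1 <= c.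
Proof.
(* Lists with fewer than two entries violate the count, so the default of [nth] never occurs.
   Otherwise, if [b] exceeded [c], so would all later entries, and only [a] could be counted. *)
case: s => [|a [|b s]] //=; first by rewrite addn0; case: (a <= c).
move=> /andP[_ pbs]; move=> cnt; rewrite leNgt; apply/negP => cb; move: cnt.
rewrite [b <= c]leNgt cb /= add0n (_ : count _ _ = 0%N) ?addn0; first by case: (a <= c).
apply/eqP; rewrite -leqn0 leqNgt -has_count -all_predC; apply/allP => x xs /=.
by rewrite -ltNge (lt_le_trans cb) // (allP (order_path_min le_trans pbs)).
Qed.

Lemma dtn_eigenvalue1_le (c : R) phi psi : 0 <= c ->
  phi != 0 -> Lambda phi = 0 -> psi \notin <[phi]>%VS -> Lambda psi = c *: psi ->
  dtn_eigenvalue mu Omega 1 <= c.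
Proof.
move=> c0 phi0 Lphi psiphi Lpsi.
have [srt cnt] := spectrumP mu Omega; apply: nth1_sorted_le => //.
set s := spectrum _ _ in cnt *.
have eig (a : R) v : Lambda v = a *: v -> (<[v]> <= passmx.leigenspace Lambda a)%VS.
  move=> Lv; rewrite -memvE memv_ker add_lfunE opp_lfunE scale_lfunE id_lfunE.
  by rewrite Lv subrr.
have eig0 : (<[phi]> <= passmx.leigenspace Lambda 0)%VS by apply: eig; rewrite scale0r.
have dim0 : (0 < count_mem 0%R s)%N.
  by rewrite cnt (leq_trans _ (dimvS eig0)) // dim_vline phi0.
(* If [c = 0], then [phi] and [psi] force the kernel to have dimension at least 2. Otherwise 0 and
   [c] are distinct eigenvalues, and each contributes at least one entry. *)
have [cE|cN0] := eqVneq c 0.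
  apply: (@leq_trans (count_mem 0%R s)); last first.
    by apply: sub_count => a /= /eqP ->.
  rewrite cnt ltnNge; apply: contra psiphi => dim1.
  have /eqP -> : <[phi]>%VS == passmx.leigenspace Lambda 0.
    by rewrite eqEdim eig0 dim_vline phi0.
  by rewrite memvE eig // -cE.
have dimc : (0 < count_mem c s)%N.
  rewrite cnt (leq_trans _ (dimvS (eig _ _ Lpsi))) // dim_vline.
  by have -> : psi != 0 by apply: contraNneq psiphi => ->; exact: mem0v.
apply: (@leq_trans (count (predU (pred1 0%R) (pred1 c)) s)); last first.
  by apply: sub_count => a /= /orP[]/eqP ->.
have := count_predUI (pred1 0%R) (pred1 c) s.
rewrite [X in (_ + X)%N](_ : _ = 0%N) ?addn0 => [->|]; last first.
  apply/eqP; rewrite -leqn0 leqNgt -has_count; apply/hasPn => a _ /=.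
  by apply/negP => /andP[/eqP -> /eqP e]; rewrite -e eqxx in cN0.
exact: (leq_add dim0 dimc).
Qed.

(* Adding a large multiple of the projection onto constants to [Lambda] leaves
   the other eigenvalues unchanged and pushes the trivial one beyond [r], so
   that the least eigenvalue of the sum comes from an eigenfunction of [Lambda]
   orthogonal to constants. *)
Lemma dtn_eigenvalue1_rayleigh (r : R) phi : phi != 0 -> dot phi bdry_one = 0 ->
  dot (Lambda phi) phi <= r * dot phi phi -> dtn_eigenvalue mu Omega 1 <= r.
Proof.
move=> phi0 phi1 phir.
have B0 : (0 < #|{: B}|)%N by rewrite card_sub.
have one0 : bdry_one != 0.
  case/card_gt0P: B0 => z _; apply/eqP => /ffunP/(_ z); rewrite !ffunE => /eqP.
  by rewrite oner_eq0.
pose M := dot bdry_one bdry_one.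
have M0 : 0 < M by apply: dotm_gt0 => //; exact: bdry_mass_gt0.
have phiphi : 0 < dot phi phi by apply: dotm_gt0 => //; exact: bdry_mass_gt0.
have r0 : 0 <= r.
  by rewrite -(pmulr_lge0 _ phiphi); apply: le_trans phir; exact: dtn_psd.
(* Chosen so that [t * M = r + 1]: the perturbed operator multiplies constants by [r + 1], which
   exceeds [r]. *)
pose t := (r + 1) / M.
have t0 : 0 <= t by rewrite divr_ge0 ?(ltW M0) ?addr_ge0.
have tM : t * M = r + 1 by rewrite /t divfK ?gt_eqF.
have [P PE] := rank_one_endo bdry_mass bdry_one.
pose f := (Lambda + t *: P)%R.
have fE x : f x = Lambda x + (t * dot x bdry_one) *: bdry_one.
  by rewrite /f add_lfunE scale_lfunE PE scalerA.
have [x y|x|c [c0 [x x0 fx] cmin]] := psd_min_eigenvalue bdry_mass_gt0 (f := f) B0.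
- by rewrite !fE dotmDl dotmDr dotmZl dotmZr dtn_sym (dotmC _ bdry_one y); ring.
- rewrite fE dotmDl dotmZl addr_ge0 ?dtn_psd // (dotmC _ bdry_one) -mulrA.
  by rewrite mulr_ge0 // -expr2 sqr_ge0.
(* Test minimality of [c] on [phi], where the perturbation vanishes by orthogonality. *)
have cr : c <= r.
  rewrite -(ler_pM2r phiphi); apply: le_trans phir; apply: le_trans (cmin _) _.
  by rewrite fE phi1 mulr0 scale0r addr0.
(* Pair the eigenvalue equation with the constant 1. By symmetry [Lambda] contributes nothing, so
   [(r + 1 - c) <x, 1> = 0], with a positive first factor. *)
have x1 : dot x bdry_one = 0.
  have /eqP : dot (f x) bdry_one = dot (c *: x) bdry_one by rewrite fx.
  rewrite fE dotmDl !dotmZl dtn_sym dtn_one dotmC dotm0l add0r -/M mulrAC tM.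
  rewrite -subr_eq0 -mulrBl mulf_eq0 => /orP[|/eqP //].
  by rewrite gt_eqF // subr_gt0 ltr_pwDr.
apply: le_trans cr; apply: (dtn_eigenvalue1_le c0 one0 dtn_one (psi := x)).
  apply: contra x0 => /vlineP[k xk]; move: x1; rewrite xk dotmZl => /eqP.
  by rewrite mulf_eq0 -/M (gt_eqF M0) orbF => /eqP ->; rewrite scale0r.
by move: fx; rewrite fE x1 mulr0 scale0r addr0.
Qed.

(** * Test functions from cuts, and the Cheeger bound *)

Lemma set_massE (A : {set V}) :
  set_mass mu Omega (A :&: bd) = \sum_(z : B) bdry_mass z * (val z \in A)%:R.
Proof.
rewrite -(big_sub bd (fun x => mass mu Omega x * (x \in A)%:R)) /set_mass.
rewrite big_mkcond [RHS]big_mkcond; apply: eq_bigr => x _; rewrite inE.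
by case: (x \in A); case: (x \in bd); rewrite //= ?mulr1 ?mulr0.
Qed.

Lemma dtn_eigenvalue1_cut (A : {set V}) :
  0 < set_mass mu Omega (A :&: bd) <= set_mass mu Omega bd / 2 ->
  dtn_eigenvalue mu Omega 1 <=
    2 * (weight mu (edge_bdry mu Omega A) / set_mass mu Omega (A :&: bd)).
Proof.
pose phi : {ffun B -> R^o} := [ffun z => (val z \in A)%:R].
have aE : dot phi bdry_one = set_mass mu Omega (A :&: bd).
  by rewrite set_massE; apply: eq_bigr => z _; rewrite !ffunE mulr1.
have aE' : dot phi phi = set_mass mu Omega (A :&: bd).
  rewrite set_massE; apply: eq_bigr => z _; rewrite !ffunE.
  by case: (_ \in A); rewrite ?mulr1 ?mulr0.
have ME : dot bdry_one bdry_one = set_mass mu Omega bd.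
  rewrite -[in RHS](finset.setTI bd) set_massE; apply: eq_bigr => z _.
  by rewrite !ffunE inE !mulr1.
rewrite -aE -ME; move: aE'; rewrite -aE.
set a := dot phi bdry_one; set M := dot bdry_one bdry_one; set W := weight _ _.
move=> aE' /andP[a0 aM].
have M0 : 0 < M by lra.
(* The component of [phi] orthogonal to constants; [a / M] is the weighted mean of [phi]. *)
pose psi := phi + (- (a / M)) *: bdry_one.
have psi1 : dot psi bdry_one = 0.
  by rewrite dotmDl dotmZl -/a -/M mulNr divfK ?subrr ?gt_eqF.
have psi2 : a / 2 <= dot psi psi.
  rewrite dotmDr dotmZr psi1 mulr0 addr0 dotmDl dotmZl aE' (dotmC _ bdry_one).
  rewrite -/a mulNr mulrAC.
  have : a * a / M <= a / 2.
    by rewrite ler_pdivrMr // -mulrA ler_pM2l // mulrC.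
  by lra.
(* Constants lie in the kernel of the symmetric [Lambda], so [psi] has the same energy as [phi], and
   the indicator of [A] is an extension of [phi]. *)
have psiW : dot (Lambda psi) psi <= W.
  have -> : Lambda psi = Lambda phi.
    by rewrite linearD linearZ /= dtn_one scaler0 addr0.
  rewrite dotmDr dotmZr (dtn_sym phi bdry_one) dtn_one (dotmC _ phi) dotm0l.
  rewrite mulr0 addr0; apply: le_trans (dirichlet_indicator A).
  exact: dirichlet_principle.
apply: (dtn_eigenvalue1_rayleigh (phi := psi)) => //.
  by apply/eqP => p0; move: psi2; rewrite p0 dotm0l; lra.
apply: le_trans psiW _.
have W0 : 0 <= W by apply: sumr_ge0 => e _; exact: edge_weight_ge0.
(* Split off [a / 2], the lower bound for [<psi, psi>], to expose the Rayleigh bound [2 W / a]. *)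
rewrite [leLHS](_ : W = 2 * (W / a) * (a / 2)); last by field; rewrite gt_eqF.
by rewrite ler_wpM2l // mulr_ge0 // divr_ge0 // ltW.
Qed.

(** This makes the set defining the Cheeger constant nonempty, so that its infimum is not a default
    value. The lighter of two boundary vertices carries at most half of the boundary mass. *)
Lemma half_mass_set : (1 < #|bd|)%N -> exists A : {set V},
  A \subset cl mu Omega /\ 0 < set_mass mu Omega (A :&: bd) <= set_mass mu Omega bd / 2.
Proof.
have m0 z : z \in bd -> 0 < mass mu Omega z.
  by move=> zb; exact: (bdry_mass_gt0 (exist _ z zb)).
case/card_gt1P => x [y] [xb yb xy].
wlog xley : x y xb yb xy / mass mu Omega x <= mass mu Omega y => [wl|].
  by case/orP: (le_total (mass mu Omega x) (mass mu Omega y));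
    apply: wl; rewrite // eq_sym.
exists [set x]; split; first by rewrite finset.sub1set bdry_cl.
rewrite (finset.setIidPl _) ?finset.sub1set // /set_mass big_set1 m0 //=.
rewrite (bigD1 x) //= (bigD1 y) /=; last by rewrite yb eq_sym.
set S := \sum_(_ | _) _.
have S0 : 0 <= S by apply: sumr_ge0 => z /andP[/andP[/m0/ltW]].
by lra.
Qed.

End DirichletForm.

Theorem proposition4p2 (R : realType) (V : finType) (mu : V -> V -> R)
    (mu_ge0 : forall x y : V, 0 <= mu x y)
    (mu_sym : forall x y : V, mu x y = mu y x)
    (Omega : {set V}) (Omega_neq0 : (0 < #|Omega|)%N)
    (Omega_conn : tilde_connected mu Omega)
    (bdry_ge2 : (2 <= #|bdry mu Omega|)%N) :
  dtn_eigenvalue mu Omega 1 <= 2 * escobar_cheeger mu Omega.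
Proof.
have bdry_gt0 : (0 < #|bdry mu Omega|)%N by apply: ltnW.
(* It suffices that half the eigenvalue is a lower bound of the nonempty set of cut quotients. *)
rewrite -ler_pdivrMl //; apply: lb_le_inf.
  have [A [Acl Am]] := half_mass_set mu_ge0 bdry_ge2.
  by eexists; exists A; split; [| exact: Am |].
move=> _ [A [_ Am ->]]; rewrite ler_pdivrMl //.
exact: dtn_eigenvalue1_cut.
Qed.
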